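(* (1) Let $a\ge 3$ be odd. Then the closure in $\mathrm{SO}(4)$ of the union of all groups $H_{a,b}$ with $b\ge 3$ odd and $\gcd(a,b)=1$, $$\mathbf{H}_a=\overline{\bigcup_{b} H_{a,b}},$$ satisfies $$\mathbf{H}_a=\left\langle [e_a,1],[1,\mathbf{j}],[\mathbf{j},1],[1,e^{\psi\mathbf{i}}]\ \middle|\ \psi\in S^1\right\rangle$$ and is a compact Lie group of dimension $1$. Its action on $\mathbb{H}\cong\mathbb{R}^4$ is absolutely irreducible, and it possesses isotropy subgroups with one-dimensional fixed point space. (2) Let $a,a'\ge 3$ be odd with $a<a'$. If $a$ divides $a'$, then $\mathbf{H}_a$ is a subgroup of $\mathbf{H}_{a'}$.
   Context: Let $\mathbb{H}$ be the quaternions with standard basis $1,\mathbf{i},\mathbf{j},\mathbf{k}$, identified with $\mathbb{R}^4$ via $(x_1,x_2,x_3,x_4)\leftrightarrow x_1+\mathbf{i}x_2+\mathbf{j}x_3+\mathbf{k}x_4$. For unit quaternions $l,r$ let $[l,r]\in\mathrm{SO}(4)$ be the linear map $x\mapsto l x\bar r$ of $\mathbb{H}$. Thus $[l,r]=[-l,-r]$ and $[l,r][l',r']=[ll',rr']$. Put $e_p=e^{\pi\mathbf{i}/p}=\cos(\pi/p)+\mathbf{i}\sin(\pi/p)$. For odd $a,b\ge 3$ with $\gcd(a,b)=1$ let $H_{a,b}=\langle[e_a,1],[1,e_b],[1,\mathbf{j}],[\mathbf{j},1]\rangle\subset\mathrm{SO}(4)$. Here $S^1=\mathbb{R}/2\pi\mathbb{Z}$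 denotes the set of angles. A real representation is absolutely irreducible if the only linear maps commuting with the group action are real multiples of the identity. The isotropy subgroup of a point $x$ is its stabilizer, and the fixed point space of a subgroup $K$ is $\mathrm{Fix}(K)=\{x: kx=x \text{ for all } k\in K\}$. *)

(* Defs.v *)
From HB Require Import structures.
From mathcomp Require Import all_boot all_order all_algebra.
From mathcomp Require Import all_classical all_reals all_analysis.
From mathcomp Require Import ring.

Set Implicit Arguments.
Unset Strict Implicit.
Unset Printing Implicit Defensive.

Import Order.TTheory GRing.Theory Num.Theory.
Import numFieldNormedType.Exports.

Local Open Scope classical_set_scope.
Local Open Scope ring_scope.

(* The quaternions are the column vectors of R^4, in the basis 1, i, j, k. *)
Section Quaternions.
Variable R : realType.

Definition quat (x1 x2 x3 x4 : R) : 'cV[R]_4 := \col_i [:: x1; x2; x3; x4]`_i.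

Definition qmul (x y : 'cV[R]_4) : 'cV[R]_4 :=
  let: (x1, x2, x3, x4) := (x 0 0, x 1 0, x 2 0, x 3 0) in
  let: (y1, y2, y3, y4) := (y 0 0, y 1 0, y 2 0, y 3 0) in
  quat (x1 * y1 - x2 * y2 - x3 * y3 - x4 * y4)
       (x1 * y2 + x2 * y1 + x3 * y4 - x4 * y3)
       (x1 * y3 - x2 * y4 + x3 * y1 + x4 * y2)
       (x1 * y4 + x2 * y3 - x3 * y2 + x4 * y1).

Definition qconj (x : 'cV[R]_4) : 'cV[R]_4 :=
  quat (x 0 0) (- x 1 0) (- x 2 0) (- x 3 0).

Definition q1 : 'cV[R]_4 := quat 1 0 0 0.
Definition qi : 'cV[R]_4 := quat 0 1 0 0.
Definition qj : 'cV[R]_4 := quat 0 0 1 0.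

(* exp (t i) *)
Definition qexpi (t : R) : 'cV[R]_4 := cos t *: q1 + sin t *: qi.

Definition e_ (p : nat) : 'cV[R]_4 := qexpi (pi / p%:R).

(* The matrix of x |-> l x r^bar, acting on columns; see [qrotE]. *)
Definition qrot (l r : 'cV[R]_4) : 'M[R]_4 :=
  \matrix_(i, j) qmul (qmul l (delta_mx j 0)) (qconj r) i 0.

Lemma quatE x1 x2 x3 x4 : let x := quat x1 x2 x3 x4 in
  (x 0 0 = x1) * (x 1 0 = x2) * (x 2 0 = x3) * (x 3 0 = x4).
Proof. by do !split; rewrite mxE. Qed.

Lemma quat_eta (x : 'cV[R]_4) : x = quat (x 0 0) (x 1 0) (x 2 0) (x 3 0).
Proof.
apply/colP; case=> -[|[|[|[|m]]]] // lti; rewrite [RHS]mxE /=;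
  by congr (x _ _); apply/val_inj.
Qed.

Lemma quat_delta (j : 'I_4) : delta_mx j 0 =
  quat (j == 0)%:R (j == 1)%:R (j == 2)%:R (j == 3)%:R.
Proof. by rewrite [LHS]quat_eta !mxE !andbT ![_ == j]eq_sym. Qed.

Lemma qmulE x1 x2 x3 x4 y1 y2 y3 y4 :
  qmul (quat x1 x2 x3 x4) (quat y1 y2 y3 y4) =
  quat (x1 * y1 - x2 * y2 - x3 * y3 - x4 * y4)
       (x1 * y2 + x2 * y1 + x3 * y4 - x4 * y3)
       (x1 * y3 - x2 * y4 + x3 * y1 + x4 * y2)
       (x1 * y4 + x2 * y3 - x3 * y2 + x4 * y1).
Proof. by rewrite /qmul !quatE. Qed.

Lemma qrotE (l r x : 'cV[R]_4) : qrot l r *m x = qmul (qmul l x) (qconj r).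
Proof.
apply/colP => i; rewrite mxE !big_ord_recl big_ord0.
have -> : ord0 = 0 :> 'I_4 by [].
have -> : lift ord0 ord0 = 1 :> 'I_4 by exact/val_inj.
have -> : lift ord0 (lift ord0 ord0) = 2 :> 'I_4 by exact/val_inj.
have -> : lift ord0 (lift ord0 (lift ord0 ord0)) = 3 :> 'I_4 by exact/val_inj.
have E j : qrot l r i j = qmul (qmul l (delta_mx j 0)) (qconj r) i 0.
  by rewrite mxE.
rewrite !E {E} !quat_delta /= [l]quat_eta /qconj [x in RHS]quat_eta !qmulE.
move: (l 0 0) (l 1 0) (l 2 0) (l 3 0) (r 0 0) (r 1 0) (r 2 0) (r 3 0).
move: (x 0 0) (x 1 0) (x 2 0) (x 3 0).
move=> x1 x2 x3 x4 l1 l2 l3 l4 r1 r2 r3 r4.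
by case: i => -[|[|[|[|m]]]] lti //; rewrite ![quat _ _ _ _ _ _]mxE /=; ring.
Qed.

End Quaternions.

Section MatrixGroups.
Variables (R : realType) (n : nat).
Implicit Types (G H K : set 'M[R]_n) (g h : 'M[R]_n) (x : 'cV[R]_n).

Definition GL : set 'M[R]_n := [set g | g \in unitmx].

Definition SO : set 'M[R]_n := [set g | g^T *m g = 1%:M /\ \det g = 1].

Definition subgroup_of G H : Prop :=
  [/\ H `<=` G, H 1%:M,
      (forall g h, H g -> H h -> H (g *m h)) &
      (forall g, H g -> H (invmx g))].

(* Meant for X `<=` SO: otherwise this is the intersection of an empty
   family, i.e., setT. *)
Definition generated (X : set 'M[R]_n) : set 'M[R]_n :=
  smallest (subgroup_of SO) X.

(* The closure in the subspace topology of SO(n). *)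
Definition closure_SO (X : set 'M[R]_n) : set 'M[R]_n := SO `&` closure X.

Definition absolutely_irreducible G : Prop :=
  forall T : 'M[R]_n, (forall g, G g -> T *m g = g *m T) ->
    exists c : R, T = c%:M.

Definition isotropy G x : set 'M[R]_n := [set g | G g /\ g *m x = x].

Definition isotropy_subgroup G K : Prop := exists x, K = isotropy G x.

Definition Fix K : set 'cV[R]_n := [set x | forall k, K k -> k *m x = x].

Definition fix_dim K (d : nat) : Prop :=
  exists V : {vspace 'cV[R]_n}, Fix K = [set x | x \in V] /\ (\dim V)%VS = d.

End MatrixGroups.

Section Smooth.
Variables (R : realType) (U V : normedModType R).

(* Class C^k on an open set D. *)
Fixpoint Ck (k : nat) (D : set U) (f : U -> V) : Prop :=
  match k with
  | 0 => forall x, D x -> {for x, continuous f}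
  | k'.+1 => (forall x, D x -> differentiable f x) /\
             forall v : U, Ck k' D ('D_v f)
  end.

Definition smooth (D : set U) (f : U -> V) : Prop := forall k, Ck k D f.

End Smooth.

Section LieGroups.
Variables (R : realType) (n d : nat).

(* The last clause says that f is a homeomorphism from W onto a relatively
   open subset of M. *)
Definition local_parametrization (M : set 'M[R]_n)
    (W : set 'rV[R]_d) (f : 'rV[R]_d -> 'M[R]_n) : Prop :=
  [/\ open W, smooth W f, {in W &, injective f},
      (forall u, W u -> injective ('d f u)) &
      (forall W' : set 'rV[R]_d, open W' -> W' `<=` W ->
         exists2 O : set 'M[R]_n, open O & f @` W' = M `&` O)].

Definition submanifold (M : set 'M[R]_n) : Prop :=
  forall g, M g -> exists W f, local_parametrization M W f /\ (f @` W) g.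

(* A d-dimensional Lie subgroup of GL(n), embedded in the space of matrices.
   Smoothness of the operations can be tested in the ambient space as the
   submanifold is embedded. *)
Definition lie_group (G : set 'M[R]_n) : Prop :=
  [/\ subgroup_of (@GL R n) G, submanifold G,
      (forall W1 f1 W2 f2, local_parametrization G W1 f1 ->
         local_parametrization G W2 f2 ->
         smooth (W1 `*` W2)
           (fun u : 'rV[R]_d * 'rV[R]_d => f1 u.1 *m f2 u.2)) &
      (forall W f, local_parametrization G W f ->
         smooth W (fun u => invmx (f u)))].

End LieGroups.

Section TheGroups.
Variable R : realType.

Definition H_ (a b : nat) : set 'M[R]_4 :=
  generated [set qrot (e_ R a) (q1 R); qrot (q1 R) (e_ R b);
                 qrot (q1 R) (qj R); qrot (qj R) (q1 R)].

Definition Hbar (a : nat) : set 'M[R]_4 :=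
  closure_SO (\bigcup_(b in [set b | [/\ odd b, (3 <= b)%N & coprime a b]])
                H_ a b).

End TheGroups.

Arguments H_ R a b : clear implicits.
Arguments Hbar R a : clear implicits.

(* Main.v *)
Require Import Defs.
From HB Require Import structures.
From mathcomp Require Import all_boot all_order all_algebra.
From mathcomp Require Import all_classical all_reals all_analysis.
From mathcomp Require Import ring lra.

Set Implicit Arguments.
Unset Strict Implicit.
Unset Printing Implicit Defensive.

Import Order.TTheory GRing.Theory Num.Theory.
Import numFieldNormedType.Exports.

Local Open Scope classical_set_scope.
Local Open Scope ring_scope.

(** Everything follows from an explicit description of the limit group: the
    elements of the closure are exactly the maps [l, r] with
      l = e_a^k j^e  (k an integer, e = 0 or 1)   and
      r = e^(ti) j^d (t a real number, d = 0 or 1),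
    that is, l runs through a binary dihedral group and r through Pin(2), the
    group formed by the circles e^(ti) and e^(ti) j. The set of these maps is
    [pin_group a], and the proof compares the two sides of each claim with it.

    Words in the unit quaternions e^(ti) j^e multiply by a simple rule
    ([pinM]), so pin_group a is a subgroup of SO(4) ([pin_group_subgroup]);
    it contains the generators and is contained in every subgroup that
    contains them ([generated_pin_group]).

    Since e_a^a = -1 and [-l, r] = [l, -r], the integer k can be taken in
    [0, a), so pin_group a is a union of 4a circles
    ([pin_group_components]). Hence it is compact, therefore closed, and it
    contains the closure of the union of the H_(a,b). Conversely, the angles
    m pi / b with b = 2an + 1 become dense as n grows, and these b are odd and
    prime to a; so every element of pin_group a is a limit of elements of the
    H_(a,b) ([Hbar_pin_group]).

    The 4a circles are disjoint, because [l, r] determines (l, r) up to a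
    common sign. So a chart at the identity is t |-> [1, e^(ti)] for
    |t| < pi: the complement in pin_group a of the image of an open set W' is
    the union of the other circles and of the image of the compact set
    [-pi, pi] minus W', hence it is closed ([local_parametrization_circle]).
    Left translation gives charts everywhere. Products and inverses are smooth
    in any charts because they are restrictions of the bilinear matrix product
    and, on SO(4), of the linear transposition ([lie_group_pin_group]).

    Finally, a quaternion that commutes with e_a and with j is real, as
    sin (pi / a) <> 0 ([commute_ej_real]). If T commutes with the group, then
    T 1 is such a quaternion, and right multiplications propagate T x = (T 1) x
    to all x; this is absolute irreducibility. The isotropy group of the point
    1 contains [e_a, e_a] and [j, j], which fix only the quaternions that
    commute with e_a and j; so its fixed point space is the real line. *)

(** * Continuity of matrix operations *)

Section MatrixContinuity.
Variable R : realType.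

Lemma continuous_entries (T : topologicalType) m n (f : T -> 'M[R]_(m, n)) :
  (forall i j, continuous (fun x => f x i j)) -> continuous f.
Proof.
move=> cf x; apply/cvg_mx_entourageP => A entA.
have : \forall y \near x, forall ij : 'I_m * 'I_n,
    (f x ij.1 ij.2, f y ij.1 ij.2) \in A.
  apply: filter_forall => -[i j] /=.
  have /(_ _ (nbhs_entourage (f x i j) entA)) := cf i j x.
  by rewrite /nbhs /=; apply: filterS => y; rewrite /xsection /= !inE.
by apply: filterS => y H i j; apply: (H (i, j)).
Qed.

Lemma continuous_sum (T : topologicalType) (I : Type) (r : seq I)
    (f : I -> T -> R) :
  (forall i, continuous (f i)) -> continuous (fun x => \sum_(i <- r) f i x).
Proof.
move=> cf x; elim: r => [|i r IH].
  by under eq_fun do rewrite big_nil; apply: cvg_cst.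
by under eq_fun do rewrite big_cons; apply: cvgD; [apply: cf | apply: IH].
Qed.

Lemma continuous_mulmx m n p :
  continuous (fun AB : 'M[R]_(m, n) * 'M[R]_(n, p) => AB.1 *m AB.2).
Proof.
apply: continuous_entries => i j.
under eq_fun do rewrite mxE.
apply: continuous_sum => k x; apply: cvgM.
  apply: (@continuous_comp _ _ _ fst (fun M : 'M[R]_(m, n) => M i k)).
    exact: cvg_fst.
  exact: coord_continuous.
apply: (@continuous_comp _ _ _ snd (fun M : 'M[R]_(n, p) => M k j)).
  exact: cvg_snd.
exact: coord_continuous.
Qed.

Lemma continuous_trmx m n : continuous (@trmx R m n).
Proof.
apply: continuous_entries => i j.
by under eq_fun do rewrite mxE; apply: coord_continuous.
Qed.

Lemma continuous_mulmxl m n p (A : 'M[R]_(m, n)) :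
  continuous (fun B : 'M[R]_(n, p) => A *m B).
Proof.
move=> B; apply: (@continuous2_cvg _ _ _ _ (nbhs B) _ (cst A) id mulmx).
- exact: (@continuous_mulmx m n p (A, B)).
- exact: cvg_cst.
- exact: cvg_id.
Qed.

End MatrixContinuity.

(** * Functions of class C^k *)

Section Ck.
Variable R : realType.

Lemma near_eq_differentiable (U V : normedModType R) (f g : U -> V) x :
  {near x, f =1 g} -> differentiable f x -> differentiable g x.
Proof.
move=> fg /diff_locallyP[cdf /eqaddoP df].
have E : g \o shift x = cst (g x) + 'd f x +o_ 0 id.
  apply/eqaddoP => e e0; have := df e e0.
  rewrite -(nbhs_singleton fg).
  have : \forall h \near (0 : U), f (h + x) = g (h + x).
    have : \forall y \near x, f y = g y by [].
    by rewrite (near_shift 0) subr0.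
  by apply: filterS2 => h /= fgh; rewrite /= !fctE /= fgh.
apply/diff_locallyP; rewrite (diff_unique cdf E); split => //.
Qed.

(** Class C^k on an open set depends only on the values there, so derivatives
    may be replaced by formulas that hold on D only. *)
Lemma Ck_eq (U V : normedModType R) k (D : set U) (f g : U -> V) :
  open D -> {in D, f =1 g} -> Ck k D f -> Ck k D g.
Proof.
move=> oD; elim: k f g => [|k IH] f g fg /=.
  move=> cf x Dx; rewrite /prop_for /continuous_at -(fg x) ?inE //.
  apply: cvg_trans (cf x Dx); apply: near_eq_cvg.
  by apply: filterS (open_nbhs_nbhs (conj oD Dx)) => y Dy; rewrite fg // inE.
move=> [df cf].
have nfg x : D x -> {near x, f =1 g}.
  move=> Dx; apply: filterS (open_nbhs_nbhs (conj oD Dx)) => y Dy.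
  by rewrite fg // inE.
split.
  by move=> x Dx; apply: near_eq_differentiable (nfg x Dx) (df x Dx).
move=> v; apply: IH (cf v) => x; rewrite inE => Dx.
exact/near_eq_derive/nfg.
Qed.

Lemma Ck_continuous (U V : normedModType R) k (D : set U) (f : U -> V) :
  Ck k D f -> forall x, D x -> {for x, continuous f}.
Proof.
by case: k => [|k] //= [df _] x Dx; apply/differentiable_continuous/df.
Qed.

Lemma CkW (U V : normedModType R) k (D : set U) (f : U -> V) :
  Ck k.+1 D f -> Ck k D f.
Proof.
elim: k f => [|k IH] f; first exact: Ck_continuous.
by move=> [df cf]; split=> // v; apply/IH/cf.
Qed.

Lemma Ck_sub (U V : normedModType R) k (D D' : set U) (f : U -> V) :
  D' `<=` D -> Ck k D f -> Ck k D' f.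
Proof.
move=> D'D; elim: k f => [|k IH] f /=; first by move=> cf x /D'D; apply: cf.
by move=> [df cf]; split=> [x /D'D|v]; [apply: df|apply/IH/cf].
Qed.

Lemma CkD (U V : normedModType R) k (D : set U) (f g : U -> V) :
  open D -> Ck k D f -> Ck k D g -> Ck k D (f \+ g).
Proof.
move=> oD; elim: k f g => [|k IH] f g /=.
  by move=> cf cg x Dx; apply: cvgD; [apply: cf|apply: cg].
move=> [df cf] [dg cg]; split.
  by move=> x Dx; apply: differentiableD; [apply: df|apply: dg].
move=> v; apply: Ck_eq (IH _ _ (cf v) (cg v)) => // x; rewrite inE => Dx.
by rewrite deriveD //; apply: diff_derivable; [apply: df|apply: dg].
Qed.

Lemma Ck_linear_post (U V W : normedModType R) (L : {linear V -> W}) k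
    (D : set U) (f : U -> V) :
  continuous L -> open D -> Ck k D f -> Ck k D (L \o f).
Proof.
move=> cL oD; elim: k f => [|k IH] f /=.
  by move=> cf x Dx; apply: continuous_comp; [apply: cf|apply: cL].
move=> [df cf].
have dL y : differentiable L y by apply: linear_differentiable.
split; first by move=> x Dx; apply: differentiable_comp => //; apply: df.
move=> v; apply: Ck_eq (IH _ (cf v)) => // x; rewrite inE => Dx.
have dfx := df x Dx.
have -> : (L \o 'D_v f) x = L ('d f x v) by rewrite /= deriveE.
rewrite deriveE; last exact: differentiable_comp.
by rewrite (@diff_comp _ _ _ _ f L) //= diff_lin.
Qed.

Lemma Ck_linear_pre (U' U V : normedModType R) (L : {linear U' -> U}) k
    (D : set U) (f : U -> V) :
  continuous L -> open D -> Ck k D f -> Ck k (L @^-1` D) (f \o L).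
Proof.
move=> cL oD; have oLD : open (L @^-1` D).
  by apply: open_comp => // x _; apply: cL.
elim: k f => [|k IH] f /=.
  by move=> cf x Dx; apply: continuous_comp; [apply: cL|apply: cf].
move=> [df cf].
have dL y : differentiable L y by apply: linear_differentiable.
split; first by move=> x Dx; apply: differentiable_comp => //; apply: df.
move=> v; apply: Ck_eq (IH _ (cf (L v))) => // x; rewrite inE => Dx.
have dfx := df _ Dx.
have -> : ('D_(L v) f \o L) x = 'd f (L x) (L v) by rewrite /= deriveE.
rewrite deriveE; last exact: differentiable_comp.
by rewrite (@diff_comp _ _ _ _ L f) //= diff_lin.
Qed.

(** The Leibniz rule expresses the derivative as a sum of two terms of the same
    shape, one order of differentiability lower; this is where [CkW] and [CkD]
    enter. *)
Lemma Ck_bilinear (U V1 V2 W : normedModType R) (B : {bilinear V1 -> V2 -> W}) k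
    (D : set U) (f : U -> V1) (g : U -> V2) :
  continuous (fun p => B p.1 p.2) -> open D ->
  Ck k D f -> Ck k D g -> Ck k D (fun x => B (f x) (g x)).
Proof.
move=> cB oD; elim: k f g => [|k IH] f g.
  move=> /= cf cg x Dx.
  apply: (continuous2_cvg (F := nbhs x)); first exact: (cB (f x, g x)).
    exact: cf.
  exact: cg.
move=> Cf Cg; have [[df cf] [dg cg]] := (Cf, Cg).
have dB y : differentiable (fun p => B p.1 p.2) y.
  by apply: differentiable_bilin.
have dfg x : D x -> differentiable (fun x => (f x, g x)) x.
  by move=> Dx; apply: differentiable_pair; [apply: df|apply: dg].
split.
  move=> x Dx; apply: (@differentiable_comp _ _ _ _ (fun x => (f x, g x))
    (fun p => B p.1 p.2)) => //.
  exact: dfg.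
move=> v.
apply: Ck_eq (CkD oD (IH _ _ (CkW Cf) (cg v)) (IH _ _ (cf v) (CkW Cg))) => //.
move=> x; rewrite inE => Dx.
have -> : (fun x => B (f x) (g x)) =
  (fun p => B p.1 p.2) \o (fun x => (f x, g x)) by [].
rewrite deriveE; last by apply: differentiable_comp => //; apply: dfg.
rewrite (@diff_comp _ _ _ _ (fun x => (f x, g x)) (fun p => B p.1 p.2)) //;
  last exact: dfg.
rewrite diff_bilin //= diff_pair /=; [|exact: df|exact: dg].
by rewrite !deriveE //; [exact: df|exact: dg].
Qed.

Lemma is_diff_trig (V : normedModType R) (P Q : V) (t : R) :
  is_diff t (fun t => cos t *: P + sin t *: Q)
    (fun h => h *: (cos t *: Q - sin t *: P)).
Proof.
have dc : differentiable cos t by apply/derivable1_diffP.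
have ds : differentiable sin t by apply/derivable1_diffP.
have dcP : differentiable (fun t : R => cos t *: P) t.
  exact: differentiableZl.
have dsQ : differentiable (fun t : R => sin t *: Q) t.
  exact: differentiableZl.
apply: DiffDef; first exact: differentiableD.
rewrite (diffD dcP dsQ) !diffZl // !deriv1E // !derive1E !derive_val.
apply/funext => h; rewrite /= addrC scalerBr !scalerA -scaleNr.
by congr (_ *: _ + _ *: _); rewrite /GRing.scale /=; ring.
Qed.

(** The derivative in direction v is again of the form
    t |-> cos t P' + sin t Q', with P' = v Q and Q' = - v P; hence induction on
    the order applies. *)
Lemma Ck_trig (V : normedModType R) k (D : set R) (P Q : V) :
  open D -> Ck k D (fun t => cos t *: P + sin t *: Q).
Proof.
move=> oD.
have df (P' Q' : V) (t : R) :
    differentiable (fun t => cos t *: P' + sin t *: Q') t.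
  by have [] := is_diff_trig P' Q' t.
elim: k P Q => [|k IH] P Q /=.
  by move=> t _; apply: differentiable_continuous.
split=> [//|v]; apply: Ck_eq (IH (v *: Q) (- v *: P)) => //.
move=> t _; rewrite deriveE // (@diff_val _ _ _ _ _ _ _ (is_diff_trig P Q t)).
by rewrite scalerBr !scalerA -scaleNr; congr (_ *: _ + _ *: _); ring.
Qed.

End Ck.

(** * Unit quaternions and the maps [l, r] *)

Section QuaternionAlgebra.
Variable R : realType.
Implicit Types (l r x y z : 'cV[R]_4) (s t : R) (e d : bool).

Lemma qmulA : associative (@qmul R).
Proof.
move=> x y z; rewrite [x]quat_eta [y]quat_eta [z]quat_eta !qmulE.
by congr quat; ring.
Qed.

Lemma qmul1q x : qmul (q1 R) x = x.
Proof. by rewrite [x]quat_eta /q1 qmulE; congr quat; ring. Qed.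

Lemma qmulq1 x : qmul x (q1 R) = x.
Proof. by rewrite [x]quat_eta /q1 qmulE; congr quat; ring. Qed.

Lemma qconjM x y : qconj (qmul x y) = qmul (qconj y) (qconj x).
Proof.
rewrite [x]quat_eta [y]quat_eta /qconj !qmulE !quatE.
by congr quat; ring.
Qed.

Lemma qconjK : involutive (@qconj R).
Proof. by move=> x; rewrite /qconj !quatE !opprK -quat_eta. Qed.

Lemma qconj1 : qconj (q1 R) = q1 R.
Proof. by rewrite /qconj /q1 !quatE !oppr0. Qed.

Lemma mulmx_inj m n (A B : 'M[R]_(m, n)) :
  (forall x : 'cV[R]_n, A *m x = B *m x) -> A = B.
Proof.
by move=> AB; apply/matrixP => i j; move/colP/(_ i): (AB (delta_mx j 0));
  rewrite -!colE !mxE.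
Qed.

Lemma qrotM l r x y : qrot l r *m qrot x y = qrot (qmul l x) (qmul r y).
Proof.
by apply: mulmx_inj => z; rewrite -mulmxA !qrotE qconjM !qmulA.
Qed.

Lemma qrot11 : qrot (q1 R) (q1 R) = 1%:M.
Proof.
by apply: mulmx_inj => z; rewrite qrotE mul1mx qconj1 qmul1q qmulq1.
Qed.

Lemma qrot_tr l r : (qrot l r)^T = qrot (qconj l) (qconj r).
Proof.
have entry x y i j : qrot x y i j = qmul (qmul x (delta_mx j 0)) (qconj y) i 0.
  by rewrite mxE.
apply/matrixP => i j; rewrite mxE !entry !quat_delta qconjK.
rewrite [l]quat_eta [r]quat_eta /qconj !qmulE.
by case: i => -[|[|[|[|//]]]] ?; case: j => -[|[|[|[|//]]]] ?;
  rewrite /= !mxE /=; ring.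
Qed.

Definition qunit l := qmul (qconj l) l = q1 R.

Lemma qunitM l r : qunit l -> qunit r -> qunit (qmul l r).
Proof.
by rewrite /qunit qconjM => ul ur; rewrite qmulA -(qmulA _ (qconj l)) ul qmulq1.
Qed.

Lemma qrot_orthogonal l r : qunit l -> qunit r ->
  (qrot l r)^T *m qrot l r = 1%:M.
Proof. by move=> ul ur; rewrite qrot_tr qrotM ul ur qrot11. Qed.

Lemma invmx_orthogonal n (g : 'M[R]_n) : g^T *m g = 1%:M -> invmx g = g^T.
Proof.
move=> gg; have [_ gu] := mulmx1_unit gg.
by rewrite -[LHS]mul1mx -gg -mulmxA mulmxV // mulmx1.
Qed.

(** A square of orthogonal matrices has determinant (+-1)^2 = 1, which spares
    the expansion of a 4 x 4 determinant. *)
Lemma qrot_sq_SO l r : qunit l -> qunit r -> SO (qrot (qmul l l) (qmul r r)).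
Proof.
move=> ul ur; split; first by apply: qrot_orthogonal; apply: qunitM.
rewrite -qrotM det_mulmx -[X in X * _]det_tr -det_mulmx.
by rewrite qrot_orthogonal // det1.
Qed.

(** The element e^(ti) j^e of Pin(2), the normalizer of the circle e^(ti) in the
    unit quaternions. *)
Definition pin t e : 'cV[R]_4 :=
  if e then quat 0 0 (cos t) (sin t) else quat (cos t) (sin t) 0 0.
Arguments pin : simpl never.

Lemma qexpi_pin t : qexpi t = pin t false.
Proof.
rewrite /qexpi /q1 /qi [LHS]quat_eta !mxE /= /pin.
by congr quat; ring.
Qed.

Lemma q1_pin : q1 R = pin 0 false.
Proof. by rewrite /pin cos0 sin0. Qed.

Lemma qj_pin : qj R = pin 0 true.
Proof. by rewrite /pin cos0 sin0. Qed.

(** From j e^(ti) = e^(-ti) j and j^2 = -1 = e^(pi i). *)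
Lemma pinM s t e d : qmul (pin s e) (pin t d) =
  pin (s + (if e then - t else t) + (if e && d then pi else 0)) (e (+) d).
Proof.
case: e d => -[]; rewrite /pin /= qmulE ?addr0 ?cosDpi ?sinDpi;
  by rewrite ?cosB ?sinB ?cosD ?sinD; congr quat; ring.
Qed.

Lemma pin_conj t e : qconj (pin t e) = pin (if e then t + pi else - t) e.
Proof.
by case: e; rewrite /pin /qconj !quatE ?cosDpi ?sinDpi ?cosN ?sinN ?oppr0.
Qed.

Lemma pin_unit t e : qunit (pin t e).
Proof.
rewrite /qunit pin_conj pinM addbb q1_pin andbb.
case: e; last by congr pin; ring.
have -> : t + pi + - t + pi = 0 + pi + pi by ring.
by rewrite /pin !(cosDpi, sinDpi) !opprK.
Qed.

End QuaternionAlgebra.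
Arguments pin {R} t%_ring_scope e : simpl never.

(** * Angles *)

Section Angles.
Variable R : realType.
Implicit Types x s t : R.

Lemma cos_eq1 x : - (pi *+ 2) < x < pi *+ 2 -> cos x = 1 -> x = 0.
Proof.
move=> /andP[x1 x2].
have {1}-> : x = x / 2 + x / 2 by lra.
rewrite cosD => c1; have c2s2 := cos2Dsin2 (x / 2).
have s0 : sin (x / 2) = 0.
  by apply/eqP; rewrite -sqrf_eq0; apply/eqP; nra.
have [x0|x0|//] := ltgtP x 0.
  have : 0 < sin (- (x / 2)) by apply: sin_gt0_pi; lra.
  by rewrite sinN s0 oppr0 ltxx.
have : 0 < sin (x / 2) by apply: sin_gt0_pi; lra.
by rewrite s0 ltxx.
Qed.

Lemma cos_sin_inj s t : - (pi *+ 2) < t - s < pi *+ 2 ->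
  cos t = cos s -> sin t = sin s -> t = s.
Proof.
move=> ts ct st; apply/eqP; rewrite -subr_eq0; apply/eqP.
apply: cos_eq1 => //; rewrite cosB ct st -!expr2; exact: cos2Dsin2.
Qed.

Lemma pinDpi2 t e (m : int) : pin (t + m%:~R * (pi *+ 2)) e = pin t e.
Proof.
have H n (u : R) : pin (u + n%:R * (pi *+ 2)) e = pin u e.
  elim: n u => [|n IH] u; first by rewrite mul0r addr0.
  rewrite -(IH u) -natr1 mulrDl addrA mul1r /pin.
  by rewrite cosD2pi sinD2pi.
case: (intP m) => [|n|n].
- by rewrite mul0r addr0.
- by rewrite -pmulrn H.
- by rewrite mulrNz -pmulrn -(H n.+1 (t + _)) mulNr subrK.
Qed.

Lemma pin_mod t e : exists2 s, - pi <= s <= pi & pin t e = pin s e.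
Proof.
have pi0 := pi_gt0 R.
pose m := Num.floor ((t + pi) / (pi *+ 2)).
have pi20 : 0 < pi *+ 2 :> R by lra.
exists (t + (- m)%:~R * (pi *+ 2)); last by rewrite pinDpi2.
have := floor_itv ((t + pi) / (pi *+ 2)); rewrite -/m => /andP[].
rewrite ler_pdivlMr // ltr_pdivrMr // intrD mulrDl mulrNz => m1 m2.
apply/andP; split; lra.
Qed.

End Angles.

(** * The group generated by e_a, j on the left and Pin(2) on the right *)

Section PinGroup.
Variable R : realType.
Implicit Types (l r : 'cV[R]_4) (s t : R) (e d : bool) (a : nat).

Definition pin_group a : set 'M[R]_4 := [set g | exists (k : int) t e d,
  g = qrot (pin (k%:~R * (pi / a%:R)) e) (pin t d)].

(** Adding pi to an angle changes the sign of that factor, and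
    [-l, r] = [l, -r]. *)
Lemma qrot_shift s t e d :
  qrot (pin (s + pi) e) (pin t d) = qrot (pin s e) (pin (t + pi) d).
Proof.
apply: mulmx_inj => x; rewrite !qrotE [x]quat_eta.
by case: e d => -[]; rewrite /pin /qconj ?cosDpi ?sinDpi !qmulE !quatE;
  congr quat; ring.
Qed.

Lemma qrot_shiftz (m : int) s t e d :
  qrot (pin (s + m%:~R * pi) e) (pin t d) =
  qrot (pin s e) (pin (t + m%:~R * pi) d).
Proof.
have H n (u v : R) : qrot (pin (u + n%:R * pi) e) (pin v d) =
    qrot (pin u e) (pin (v + n%:R * pi) d).
  elim: n u v => [|n IH] u v; first by rewrite !mul0r !addr0.
  by rewrite -natr1 mulrDl mul1r (addrA u) (addrA v) qrot_shift IH addrAC.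
case: (intP m) => [|n|n]; first by rewrite !mul0r !addr0.
  by rewrite -pmulrn H.
rewrite mulrNz -pmulrn mulNr.
by rewrite -[in RHS](subrK (n.+1%:R * pi) s) H subrK.
Qed.

(** Every element of Pin(2) is the square of a unit quaternion, so that
    [qrot_sq_SO] applies. *)
Lemma pin_SO s t e d : SO (qrot (pin s e) (pin t d)).
Proof.
have sqrt_pin u c : exists2 q : 'cV[R]_4, qunit q & pin u c = qmul q q.
  case: c; last first.
    exists (pin (u / 2) false); first exact: pin_unit.
    by rewrite pinM /= addr0; congr pin; lra.
  (* For a unit imaginary quaternion q, ((1 + q) / sqrt 2)^2 = q. *)
  pose h : R := (Num.sqrt 2)^-1.
  have h2 : h * h = 2^-1 by rewrite -expr2 exprVn sqr_sqrtr.
  exists (quat h 0 (h * cos u) (h * sin u)).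
    rewrite /qunit /qconj /q1 !qmulE !quatE; congr quat; try ring.
    transitivity (h * h + h * h * (cos u ^+ 2 + sin u ^+ 2)); first by ring.
    by rewrite cos2Dsin2 h2; lra.
  rewrite /pin !qmulE; congr quat.
  - transitivity (h * h - h * h * (cos u ^+ 2 + sin u ^+ 2)); last by ring.
    by rewrite cos2Dsin2 mulr1 subrr.
  - by ring.
  - by transitivity ((h * h + h * h) * cos u); [rewrite h2; lra|ring].
  - by transitivity ((h * h + h * h) * sin u); [rewrite h2; lra|ring].
have [l ul ->] := sqrt_pin s e; have [r ur ->] := sqrt_pin t d.
exact: qrot_sq_SO.
Qed.

Lemma pin_group_subgroup a : (0 < a)%N -> subgroup_of (@SO R 4) (pin_group a).
Proof.
move=> a0; pose th : R := pi / a%:R.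
have aE : pi = (a%:Z)%:~R * th.
  by rewrite mulrCA divff ?mulr1 // pnatr_eq0 -lt0n.
split.
- by move=> _ [k [t [e [d ->]]]]; apply: pin_SO.
- by exists 0, 0, false, false; rewrite mul0r -q1_pin qrot11.
- move=> _ _ [k [t [e [d ->]]]] [k' [t' [e' [d' ->]]]].
  exists (k + (if e then - k' else k') + (if e && e' then a%:Z else 0)).
  exists (t + (if d then - t' else t') + (if d && d' then pi else 0)).
  exists (e (+) e'), (d (+) d').
  rewrite qrotM !pinM -/th; have -> : (k + (if e then - k' else k') +
    (if e && e' then a%:Z else 0))%:~R * th = k%:~R * th +
    (if e then - (k'%:~R * th) else k'%:~R * th) + (if e && e' then pi else 0).
    by rewrite aE; case: e e' => -[] /=; rewrite !intrD ?mulrNz; ring.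
  by [].
- move=> _ [k [t [e [d ->]]]].
  rewrite invmx_orthogonal ?qrot_orthogonal //; try exact: pin_unit.
  rewrite qrot_tr !pin_conj.
  exists (if e then k + a%:Z else - k).
  exists (if d then t + pi else - t), e, d.
  rewrite -/th; have -> : (if e then k + a%:Z else - k)%:~R * th =
    if e then k%:~R * th + pi else - (k%:~R * th).
    by rewrite aE; case: e; rewrite ?intrD ?mulrNz; ring.
  by [].
Qed.

Lemma subgroup_zpow (H : set 'M[R]_4) (phi : R -> 'M[R]_4) x (k : int) :
  subgroup_of (@SO R 4) H -> phi 0 = 1%:M ->
  (forall s t, phi (s + t) = phi s *m phi t) ->
  H (phi x) -> H (phi (k%:~R * x)).
Proof.
move=> [_ H1 HM HV] phi0 phiD Hx.
have Hn n : H (phi (n%:R * x)).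
  elim: n => [|n IH]; first by rewrite mul0r phi0.
  by rewrite -natr1 mulrDl mul1r phiD; apply: HM.
case: (intP k) => [|n|n]; [by rewrite mul0r phi0|by rewrite -pmulrn|].
rewrite mulrNz -pmulrn mulNr.
have E : phi (- (n.+1%:R * x)) *m phi (n.+1%:R * x) = 1%:M.
  by rewrite -phiD addNr.
suff -> : phi (- (n.+1%:R * x)) = invmx (phi (n.+1%:R * x)) by apply: HV.
have [_ u] := mulmx1_unit E.
by rewrite -[RHS]mul1mx -E mulmxK.
Qed.

Lemma qrot_pinD_l s t : qrot (pin (s + t) false) (q1 R) =
  qrot (pin s false) (q1 R) *m qrot (pin t false) (q1 R).
Proof. by rewrite qrotM pinM qmul1q /= addr0. Qed.

Lemma qrot_pinD_r s t : qrot (q1 R) (pin (s + t) false) =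
  qrot (q1 R) (pin s false) *m qrot (q1 R) (pin t false).
Proof. by rewrite qrotM pinM qmul1q /= addr0. Qed.

(** [e_a^k j^e, e^(ti) j^d] is the product of [e_a, 1]^k, [j, 1]^e, [1, e^(ti)]
    and [1, j]^d. This covers both the generators of H_(a,b), with t a
    multiple of pi / b, and those of the limit group, with t arbitrary. *)
Lemma subgroup_pin (H : set 'M[R]_4) a (k : int) t e d :
  subgroup_of (@SO R 4) H -> H (qrot (e_ R a) (q1 R)) ->
  H (qrot (q1 R) (qj R)) -> H (qrot (qj R) (q1 R)) ->
  H (qrot (q1 R) (pin t false)) ->
  H (qrot (pin (k%:~R * (pi / a%:R)) e) (pin t d)).
Proof.
move=> sH Ha Hrj Hlj Ht; have [_ H1 HM _] := sH.
have Hk : H (qrot (pin (k%:~R * (pi / a%:R)) false) (q1 R)).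
  apply: (@subgroup_zpow _ (fun u => qrot (pin u false) (q1 R))) => //.
  - by rewrite -q1_pin qrot11.
  - exact: qrot_pinD_l.
  - by rewrite -qexpi_pin.
have -> : qrot (pin (k%:~R * (pi / a%:R)) e) (pin t d) =
   (qrot (pin (k%:~R * (pi / a%:R)) false) (q1 R) *m
     (if e then qrot (qj R) (q1 R) else 1%:M)) *m
   (qrot (q1 R) (pin t false) *m (if d then qrot (q1 R) (qj R) else 1%:M)).
  rewrite -qrot11; case: e d => -[];
  by rewrite !qrotM !qmul1q !qmulq1 ?qj_pin ?pinM /= ?addr0.
by apply: (HM _ _ (HM _ _ Hk _) (HM _ _ Ht _)); [case: e|case: d].
Qed.

Lemma pin_group_pin a (k : int) t e d :
  pin_group a (qrot (pin (k%:~R * (pi / a%:R)) e) (pin t d)).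
Proof. by exists k, t, e, d. Qed.

Lemma pin_group_generators a t :
  [/\ pin_group a (qrot (e_ R a) (q1 R)), pin_group a (qrot (q1 R) (qj R)),
      pin_group a (qrot (qj R) (q1 R)) & pin_group a (qrot (q1 R) (qexpi t))].
Proof.
rewrite /e_ !qexpi_pin q1_pin qj_pin; split.
- by exists 1, 0, false, false; rewrite mul1r.
- by exists 0, 0, false, true; rewrite mul0r.
- by exists 0, 0, true, false; rewrite mul0r.
- by exists 0, t, false, false; rewrite mul0r.
Qed.

Lemma generated_pin_group a : (0 < a)%N ->
  generated ([set qrot (e_ R a) (q1 R); qrot (q1 R) (qj R);
                  qrot (qj R) (q1 R)] `|`
             [set qrot (q1 R) (qexpi psi) | psi in [set: R]]) = pin_group a.
Proof.
move=> a0; apply/seteqP; split.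
  apply: smallest_sub; first exact: pin_group_subgroup.
  have [g1 g2 g3 _] := pin_group_generators a 0.
  move=> g [[[|]|]|[t _ <-]] => [->|->|->|] //.
  by have [] := pin_group_generators a t.
move=> _ [k [t [e [d ->]]]] H [sH XH]; apply: subgroup_pin => //; apply: XH.
- by left; left; left.
- by left; left; right.
- by left; right.
- by right; exists t => //; rewrite qexpi_pin.
Qed.

Lemma H_sub_pin_group a b : (0 < a)%N -> H_ R a b `<=` pin_group a.
Proof.
move=> a0; apply: smallest_sub; first exact: pin_group_subgroup.
have [g1 g2 g3 g4] := pin_group_generators a (pi / b%:R).
by move=> g [[[|]|]|] ->; rewrite ?qexpi_pin.
Qed.

Lemma H_pin a b (k m : int) e d :
  H_ R a b (qrot (pin (k%:~R * (pi / a%:R)) e) (pin (m%:~R * (pi / b%:R)) d)).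
Proof.
move=> H [sH XH]; apply: subgroup_pin => //.
- by apply: XH; left; left; left.
- by apply: XH; left; right.
- by apply: XH; right.
apply: (@subgroup_zpow _ (fun u => qrot (q1 R) (pin u false))) => //.
- by rewrite -q1_pin qrot11.
- exact: qrot_pinD_r.
- by apply: XH; left; left; right; rewrite -qexpi_pin.
Qed.

End PinGroup.
Arguments pin_group R a : clear implicits.

(** * Components, compactness and the closure *)

Section Components.
Variables (R : realType) (a : nat).
Hypothesis a_gt0 : (0 < a)%N.
Implicit Types (l r : 'cV[R]_4) (s t : R) (e d : bool).

Lemma qrot_pinE l t d : qrot l (pin t d) =
  cos t *: qrot l (pin 0 d) + sin t *: qrot l (pin (pi / 2) d).
Proof.
apply: mulmx_inj => x; rewrite mulmxDl -!scalemxAl !qrotE.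
move: (qmul l x) => y; rewrite [y]quat_eta.
by case: d; rewrite /pin cos0 sin0 cos_pihalf sin_pihalf /qconj !qmulE !quatE;
  rewrite [RHS]quat_eta !mxE /=; congr quat; ring.
Qed.

Lemma continuous_qrot_pin l d : continuous (fun t => qrot l (pin t d)).
Proof.
move=> t; under eq_fun do rewrite qrot_pinE.
exact: (Ck_continuous (Ck_trig 0 _ _ openT)).
Qed.

Definition component (i : 'I_a * bool * bool) t : 'M[R]_4 :=
  qrot (pin (i.1.1%:R * (pi / a%:R)) i.1.2) (pin t i.2).

Definition id_index : 'I_a * bool * bool := (Ordinal a_gt0, false, false).

(** Division of k by a leaves a remainder in [0, a) and a multiple of pi in the
    left angle, which [qrot_shiftz] moves to the right angle. *)
Lemma pin_group_components :
  pin_group R a = \bigcup_i component i @` `[- pi, pi].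
Proof.
apply/seteqP; split; last first.
  move=> _ [[[k e] d] _ [t _ <-]]; rewrite /component /= pmulrn.
  exact: pin_group_pin.
move=> _ [k [t [e [d ->]]]].
have aR0 : a%:R != 0 :> R by rewrite pnatr_eq0 -lt0n.
have az : (a%:Z != 0)%R by rewrite -lt0n.
pose j := `|(k %% a%:Z)%Z|%N.
have jE : j%:Z = (k %% a%:Z)%Z by rewrite gez0_abs // modz_ge0.
have ja : (j < a)%N by rewrite -ltz_nat jE ltz_pmod.
have kE : k%:~R * (pi / a%:R) =
    j%:R * (pi / a%:R) + (k %/ a%:Z)%Z%:~R * pi :> R.
  rewrite {1}(divz_eq k a) -jE intrD intrM mulrDl addrC -!pmulrn; congr (_ + _).
  by rewrite -mulrA [a%:R * _]mulrC divfK.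
rewrite kE qrot_shiftz.
have [s s_pi ->] := pin_mod (t + (k %/ a%:Z)%Z%:~R * pi) d.
by exists (Ordinal ja, e, d) => //; exists s; rewrite //= in_itv.
Qed.

(** The compact sets C i are arbitrary so that the lemma applies both to the
    whole group and to the complement of an arc of one circle. *)
Lemma compact_components (C : 'I_a * bool * bool -> set R) :
  (forall i, compact (C i)) -> compact (\bigcup_i component i @` C i).
Proof.
move=> cC.
have -> : \bigcup_i component i @` C i =
    \bigcup_(i in [set` index_enum ('I_a * bool * bool)%type])
      component i @` C i.
  by apply: eq_bigcupl; split => i /= _; rewrite ?mem_index_enum.
rewrite bigcup_seq; apply: bigsetU_compact => i _.
apply: continuous_compact; last exact: cC.
by apply: continuous_subspaceT => t; apply: continuous_qrot_pin.
Qed.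

Lemma compact_pin_group : compact (pin_group R a).
Proof.
rewrite pin_group_components; apply: compact_components => i.
exact: segment_compact.
Qed.

Lemma closed_pin_group : closed (pin_group R a).
Proof. by apply: compact_closed compact_pin_group; apply: norm_hausdorff. Qed.

(** The group pin_group a is closed and contains every H_(a,b). Conversely an
    angle t is at distance less than pi / b from a multiple of pi / b, and there
    are arbitrarily large odd b prime to a, for instance b = 2an + 1. *)
Lemma Hbar_pin_group : Hbar R a = pin_group R a.
Proof.
apply/seteqP; split.
  move=> g [_ cg]; apply: closed_pin_group; move: cg; apply: closure_subset.
  by move=> h [b _]; apply: H_sub_pin_group.
move=> g Mg; split.
  by have [MSO _ _ _] := pin_group_subgroup R a_gt0; apply: MSO.
move: Mg => [k [t [e [d ->]]]] B nB.
have /nbhs_ballP[eps /= eps0 ballB] := @continuous_qrot_pin _ d t _ nB.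
have pi0 := pi_gt0 R.
pose n := (Num.truncn (pi / eps)).+1.
pose b := (a * n).*2.+1.
have b_gt0 : 0 < b%:R :> R by rewrite ltr0n.
have bn : pi / b%:R < eps.
  rewrite ltr_pdivrMr // mulrC -ltr_pdivrMr //.
  have : pi / eps < n%:R by apply: truncnS_gt.
  move=> /lt_le_trans; apply; rewrite ler_nat /b -addnn.
  by apply/leqW/(leq_trans _ (leq_addr _ _)); rewrite leq_pmull.
pose m := Num.floor (t / (pi / b%:R)).
have pb0 : 0 < pi / b%:R :> R by apply: divr_gt0.
exists (qrot (pin (k%:~R * (pi / a%:R)) e) (pin (m%:~R * (pi / b%:R)) d)).
split.
  exists b; last exact: H_pin.
  split; first by rewrite /b /= odd_double.
    by rewrite /b ltnS (leq_double 1) muln_gt0 a_gt0.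
  by rewrite /= /coprime /b -addn1 -muln2 -mulnA mulnC gcdnMDl gcdn1.
apply: ballB; rewrite /ball /=; clearbody b.
move: (pi / b%:R) bn pb0 @m => p bn pb0 m.
have := floor_itv (t / p); rewrite -/m => /andP[].
rewrite ler_pdivlMr // ltr_pdivrMr // intrD mulr1z mulrDl mul1r => m1 m2.
rewrite ltr_norml; apply/andP; split; lra.
Qed.

(** The entries of [l, r] are linear in the products of a coordinate of l and a
    coordinate of r, and determine these products. The two that separate the
    component of the identity from the others are read off the traces of [l, r]
    and of [l, r] composed with right multiplication by i. *)
Lemma qrot_coef l r l' r' : qrot l r = qrot l' r' ->
  l 0 0 * r 0 0 = l' 0 0 * r' 0 0 /\ l 0 0 * r 1 0 = l' 0 0 * r' 1 0.
Proof.
have entry x y i j :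
    qrot x y i j = qmul (qmul x (delta_mx j 0)) (qconj y) i 0 :> R.
  by rewrite mxE.
have tr0 (x y : 'cV[R]_4) :
    qrot x y 0 0 + qrot x y 1 1 + qrot x y 2 2 + qrot x y 3 3 =
    4 * (x 0 0 * y 0 0).
  rewrite !entry !quat_delta [x]quat_eta [y]quat_eta /qconj !qmulE !quatE /=.
  by ring.
have tr1 (x y : 'cV[R]_4) :
    qrot x y 0 1 - qrot x y 1 0 + qrot x y 3 2 - qrot x y 2 3 =
    4 * (x 0 0 * y 1 0).
  rewrite !entry !quat_delta [x]quat_eta [y]quat_eta /qconj !qmulE !quatE /=.
  by ring.
move=> E; split; apply: (@mulfI _ (4 : R)); rewrite ?pnatr_eq0 //.
  by rewrite -!tr0 E.
by rewrite -!tr1 E.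
Qed.

(** Let i = (k, e, d). If e = 1, the left factor e^(k pi i / a) j has no
    component on 1; if d = 1, the right factor e^(si) j has none on 1 and i. In
    both cases [qrot_coef] would give cos t = sin t = 0. Otherwise
    (cos t, sin t) = cos (k pi / a) (cos s, sin s); comparing norms gives
    sin (k pi / a) = 0, hence k = 0 as 0 <= k < a. *)
Lemma component_inj i s t : `]- pi, pi[%classic t -> `[- pi, pi]%classic s ->
  qrot (q1 R) (pin t false) = component i s -> i = id_index /\ s = t.
Proof.
case: i => [[k e] d]; rewrite /= !in_itv /= => /andP[t1 t2] /andP[s1 s2].
rewrite /component /= => /qrot_coef[].
have cst := cos2Dsin2 t; have pi0 := pi_gt0 R.
have a0 : 0 < a%:R :> R by rewrite ltr0n.
set th := k%:R * (pi / a%:R).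
have th0 : 0 <= th by rewrite mulr_ge0 // divr_ge0 // ltW.
have thpi : th < pi.
  by rewrite /th mulrCA gtr_pMr // ltr_pdivrMr // mul1r ltr_nat.
have css := cos2Dsin2 s; have csth := cos2Dsin2 th.
rewrite q1_pin /pin !cos0; case: e; first by rewrite !quatE !mul0r !mul1r; nra.
case: d; first by rewrite !quatE !mulr0 !mul1r; nra.
rewrite !quatE !mul1r => ct st.
have sin0 : sin th = 0.
  apply/eqP; rewrite -sqrf_eq0; apply/eqP.
  have : cos th ^+ 2 * (cos s ^+ 2 + sin s ^+ 2) = 1.
    by rewrite mulrDr -!exprMn -ct -st.
  by rewrite css; lra.
have th_0 : th = 0.
  move: th0; rewrite le_eqVlt => /orP[/eqP <- //|thgt0].
  by have := @sin_gt0_pi _ th; rewrite sin0 ltxx thgt0 thpi => /(_ isT).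
move: ct st; rewrite th_0 cos0 !mul1r => ct st.
split; last by apply/esym/cos_sin_inj => //; apply/andP; split; lra.
have k0 : k = Ordinal a_gt0.
  apply/val_inj/eqP; move/eqP: th_0.
  rewrite mulf_eq0 pnatr_eq0 => /orP[//|/eqP p0].
  by have : 0 < pi / a%:R :> R by [apply: divr_gt0]; rewrite p0 ltxx.
by rewrite k0.
Qed.

End Components.

(** * The Lie group structure *)

Section LieGroup.
Variables (R : realType) (a : nat).
Hypothesis a_gt0 : (0 < a)%N.

Lemma local_parametrization_translate n d (M : set 'M[R]_n) (W : set 'rV[R]_d)
    (f : 'rV[R]_d -> 'M[R]_n) (g : 'M[R]_n) :
  g \in unitmx -> (forall h, M (g *m h) <-> M h) ->
  local_parametrization M W f ->
  local_parametrization M W (fun u => g *m f u).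
Proof.
move=> gu gM [oW sf fi dfi fo].
have cg : continuous (mulmx g : 'M[R]_n -> 'M[R]_n) by apply: continuous_mulmxl.
split; first exact: oW.
- by move=> k; apply: (@Ck_linear_post R _ _ _ (mulmx g)) => //; apply: sf.
- by move=> u v Wu Wv /(can_inj (mulKmx gu)); apply: fi.
- move=> u Wu v w.
  have df : differentiable f u by have [+ _] := sf 1%N; apply.
  rewrite (@diff_comp R _ _ _ f (mulmx g)) //;
    last exact: linear_differentiable.
  rewrite /= (diff_lin _ cg) => /(can_inj (mulKmx gu)).
  exact: dfi.
- move=> W' oW' W'W; have [U oU fU] := fo W' oW' W'W.
  exists (mulmx (invmx g) @^-1` U).
    by apply: open_comp oU => h _; apply: continuous_mulmxl.
  apply/seteqP; split.
    move=> _ [u W'u <-]; have : (f @` W') (f u) by exists u.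
    rewrite fU => -[Mu Ou]; split; first exact/gM.
    by rewrite /= mulKmx.
  move=> h [Mh Oh].
  have : (M `&` U) (invmx g *m h) by split => //; apply/gM; rewrite mulKVmx.
  by rewrite -fU => -[u W'u fu]; exists u; rewrite // fu mulKVmx.
Qed.

(** Charts have the domain 'rV_1; as this coordinate is a linear map, smoothness
    is transported from R by [Ck_linear_pre]. *)
Definition coord0 (u : 'rV[R]_1) : R := u 0 0.

Fact coord0_is_linear : linear coord0.
Proof. by move=> c u v; rewrite /coord0 !mxE. Qed.

HB.instance Definition _ :=
  GRing.isLinear.Build R 'rV[R]_1 R _ coord0 coord0_is_linear.

Lemma coord0_continuous : continuous coord0.
Proof. exact: coord_continuous. Qed.

Lemma coord0_inj : injective coord0.
Proof. by move=> u v uv; apply/rowP => i; rewrite ord1. Qed.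

Definition circle (t : R) : 'M[R]_4 := qrot (q1 R) (pin t false).

Lemma circleE t : circle t = cos t *: circle 0 + sin t *: circle (pi / 2).
Proof. exact: qrot_pinE. Qed.

(** The image of W' is open in the group because its complement there is
    compact: it consists of the other circles, parametrized by [-pi, pi], and
    of the image of [-pi, pi] minus W'; [component_inj] says that the image of
    W' does not meet it. *)
Lemma local_parametrization_circle : local_parametrization (pin_group R a)
  (coord0 @^-1` `]- pi, pi[) (circle \o coord0).
Proof.
have oI : open (`]- pi, pi[%classic : set R) by apply: interval_open.
have circ : circle = fun t => cos t *: circle 0 + sin t *: circle (pi / 2).
  by apply/funext => t; apply: circleE.
have circM s : circle s = component (id_index a_gt0) s.
  by rewrite /component /= mul0r -q1_pin.
have incl (t : R) : `]- pi, pi[%classic t -> `[- pi, pi]%classic t.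
  by apply: subset_itv_oo_cc.
split.
- by apply: open_comp oI => u _; apply: coord0_continuous.
- move=> k; apply: (@Ck_linear_pre R _ _ _ coord0) => //.
    exact: coord0_continuous.
  by rewrite circ; apply: Ck_trig.
- move=> u v; rewrite !inE => Wu Wv /= uv; apply: coord0_inj.
  apply/esym.
  have [] // := @component_inj _ _ a_gt0 (id_index a_gt0) (coord0 v) (coord0 u).
    exact: incl.
  by rewrite -circM.
- move=> u _ v w.
  have dc : differentiable circle (coord0 u).
    rewrite circ.
    by have [] := is_diff_trig (circle 0) (circle (pi / 2)) (coord0 u).
  rewrite (@diff_comp R _ _ _ coord0 circle) //; last first.
    by apply: linear_differentiable; apply: coord0_continuous.
  rewrite /= (diff_lin _ coord0_continuous) circ.
  rewrite (@diff_val _ _ _ _ _ _ _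
    (is_diff_trig (circle 0) (circle (pi / 2)) (coord0 u))).
  have -> : cos (coord0 u) *: circle (pi / 2) - sin (coord0 u) *: circle 0 =
      circle (coord0 u + pi / 2).
    by rewrite [RHS]circleE cosDpihalf sinDpihalf scaleNr addrC.
  (* The velocity is an element of SO(4), hence does not vanish. *)
  have nz : circle (coord0 u + pi / 2) != 0.
    apply/eqP => c0; have [_] := pin_SO 0 (coord0 u + pi / 2) false false.
    by rewrite -q1_pin -/(circle _) c0 det0 => /esym/eqP; rewrite oner_eq0.
  move=> /eqP; rewrite -subr_eq0 -scalerBl scaler_eq0 (negPf nz) orbF subr_eq0.
  by move=> /eqP; apply: coord0_inj.
- move=> W' oW' W'W.
  pose i1 := id_index a_gt0.
  pose C i := `[- pi, pi] `&` [set t : R | ~ (i = i1 /\ W' (const_mx t))].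
  have coordK t : coord0 (const_mx t) = t by rewrite /coord0 mxE.
  have cC i : compact (C i).
    apply: compact_closedI; first exact: segment_compact.
    have [->|ii] := pselect (i = i1); last first.
      rewrite (_ : [set _ | _] = setT); first exact: closedT.
      by apply/seteqP; split => // t _ [].
    rewrite (_ : [set _ | _] = ~` ((fun t => const_mx t) @^-1` W')).
      apply: open_closedC; apply: open_comp oW' => t _.
      apply: (@continuous_entries R R 1 1 const_mx) => i' j'.
      by under eq_fun do rewrite mxE; move=> ?; apply: cvg_id.
    by apply/seteqP; split => t /= H1 H2; apply: H1; [split|case: H2].
  exists (~` (\bigcup_i @component R a i @` C i)).
    apply: closed_openC; apply: compact_closed; first exact: norm_hausdorff.
    exact: compact_components.
  apply/seteqP; split.
    move=> _ [u W'u <-]; split.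
      rewrite /= circM (pin_group_components R a_gt0).
      exists i1 => //; exists (coord0 u) => //.
      exact: (incl _ (W'W _ W'u)).
    move=> [i _ [s [s_pi Cs] E]]; apply: Cs.
    have [-> ->] := component_inj a_gt0 (W'W _ W'u) s_pi (esym E).
    split => //; rewrite (_ : const_mx _ = u) //.
    by apply: coord0_inj; rewrite coordK.
  move=> h; rewrite (pin_group_components R a_gt0) => -[[i _ [s s_pi <-]] NC].
  have [[-> W's]|nW] := pselect (i = i1 /\ W' (const_mx s)).
    by exists (const_mx s) => //; rewrite /= coordK circM.
  by case: NC; exists i => //; exists s.
Qed.

(** Arbitrary charts f1, f2 are composed with the ambient operations: the
    bilinear matrix product, and transposition, which agrees with inversion
    on SO(4). *)
Lemma lie_group_pin_group : lie_group 1 (pin_group R a).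
Proof.
have [MSO M1 MM MV] := pin_group_subgroup R a_gt0.
have unitM g : pin_group R a g -> g \in unitmx.
  by move=> /MSO[/mulmx1_unit[_]].
split.
- by split.
- move=> g Mg.
  exists (coord0 @^-1` `]- pi, pi[), (fun u => g *m circle (coord0 u)).
  split.
    apply: local_parametrization_translate local_parametrization_circle.
      exact: unitM.
    move=> h; split => [Mgh|]; last exact: MM.
    by rewrite -(mulKmx (unitM _ Mg) h); apply: MM => //; apply: MV.
  exists 0; first by rewrite /= /coord0 mxE in_itv /= oppr_lt0 pi_gt0.
  by rewrite /coord0 mxE /circle -q1_pin qrot11 mulmx1.
- move=> W1 f1 W2 f2 [oW1 sf1 _ _ _] [oW2 sf2 _ _ _] k.
  have cfst : continuous (fst : 'rV[R]_1 * 'rV[R]_1 -> 'rV[R]_1).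
    by move=> ?; apply: cvg_fst.
  have csnd : continuous (snd : 'rV[R]_1 * 'rV[R]_1 -> 'rV[R]_1).
    by move=> ?; apply: cvg_snd.
  have oW : open (W1 `*` W2).
    by apply: openI; apply: open_comp.
  apply: (@Ck_bilinear R _ _ _ _ (@mulmx R 4 4 4)) => //.
  + exact: continuous_mulmx.
  + apply: (@Ck_sub _ _ _ _ (fst @^-1` W1)); first by move=> u [].
    by apply: (@Ck_linear_pre R _ _ _ fst) => //; apply: sf1.
  + apply: (@Ck_sub _ _ _ _ (snd @^-1` W2)); first by move=> u [].
    by apply: (@Ck_linear_pre R _ _ _ snd) => //; apply: sf2.
- move=> W f [oW sf _ _ fo] k.
  have [U _ fU] := fo W oW (@subset_refl _ W).
  apply: Ck_eq (Ck_linear_post (@continuous_trmx R 4 4) oW (sf k)) => // u.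
  rewrite inE => Wu /=.
  have : (pin_group R a `&` U) (f u) by rewrite -fU; exists u.
  by move=> [/MSO[fu _] _]; rewrite invmx_orthogonal.
Qed.

End LieGroup.

(** * Irreducibility and isotropy *)

Section Representation.
Variables (R : realType) (a : nat).
Hypothesis a_ge3 : (3 <= a)%N.
Implicit Types (x y : 'cV[R]_4).

Lemma sin_piV_neq0 : sin (pi / a%:R : R) != 0.
Proof.
have pi0 := pi_gt0 R.
have a0 : 0 < a%:R :> R by rewrite ltr0n (leq_trans _ a_ge3).
rewrite gt_eqF // sin_gt0_pi // divr_gt0 //= ltr_pdivrMr // -[X in X < _]mulr1.
by rewrite ltr_pM2l // ltr1n (leq_trans _ a_ge3).
Qed.

(** Commuting with e_a = cos (pi / a) + sin (pi / a) i means commuting with i,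
    as sin (pi / a) <> 0; a quaternion that commutes with i and j is central. *)
Lemma commute_ej_real y :
  qmul (e_ R a) y = qmul y (e_ R a) -> qmul (qj R) y = qmul y (qj R) ->
  y = y 0 0 *: q1 R.
Proof.
have s0 := sin_piV_neq0.
rewrite /e_ qexpi_pin /pin /qj {1 2 3 4}[y]quat_eta !qmulE => Ee Ej.
have y4 : y 3 0 = 0.
  apply: (mulfI s0); have /colP/(_ 2) := Ee; rewrite !mxE /=; lra.
have y3 : y 2 0 = 0.
  apply: (mulfI s0); have /colP/(_ 3) := Ee; rewrite !mxE /=; lra.
have y2 : y 1 0 = 0.
  have /colP/(_ 3) := Ej; rewrite !mxE /=; lra.
rewrite [LHS]quat_eta y2 y3 y4 [RHS]quat_eta /q1 !mxE /=.
by congr quat; ring.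
Qed.

Lemma qmul_realC (c : R) x : qmul (c *: q1 R) x = c *: x.
Proof.
rewrite [RHS]quat_eta [x]quat_eta /qmul /q1 !mxE /=.
by congr quat; ring.
Qed.

(** Right multiplications by Pin(2), whose elements span the quaternions, force
    T x = (T 1) x. In particular T e_a = (T 1) e_a and T j = (T 1) j; the left
    multiplications give T e_a = e_a (T 1) and T j = j (T 1), so T 1 is real. *)
Lemma absolutely_irreducible_pin_group : absolutely_irreducible (pin_group R a).
Proof.
move=> T TM; pose t := T *m q1 R.
have comm g : pin_group R a g ->
    forall x : 'cV[R]_4, T *m (g *m x) = g *m (T *m x).
  by move=> Mg x; rewrite !mulmxA TM.
have Tl l : pin_group R a (qrot l (q1 R)) -> T *m l = qmul l t.
  by move=> /comm/(_ (q1 R)); rewrite !qrotE qconj1 !qmulq1.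
have Tr s d : T *m pin s d = qmul t (pin s d).
  have := pin_group_pin a 0 (if d then s + pi else - s) false d.
  rewrite mul0r -q1_pin -pin_conj => /comm/(_ (q1 R)).
  by rewrite !qrotE qconjK !qmul1q.
have [g1 _ g3 _] := pin_group_generators a (0 : R).
have tE : t = t 0 0 *: q1 R.
  apply: commute_ej_real.
    by rewrite -(Tl _ g1) /e_ qexpi_pin Tr.
  by rewrite -(Tl _ g3) qj_pin Tr.
exists (t 0 0); apply: mulmx_inj => x; rewrite mul_scalar_mx.
have Tpin s d : T *m pin s d = t 0 0 *: pin s d.
  by rewrite Tr {1}tE qmul_realC.
have -> : x = x 0 0 *: pin 0 false + x 1 0 *: pin (pi / 2) false +
    x 2 0 *: pin 0 true + x 3 0 *: pin (pi / 2) true.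
  rewrite /pin cos0 sin0 cos_pihalf sin_pihalf.
  rewrite [LHS]quat_eta [RHS]quat_eta !mxE /=.
  by congr quat; ring.
rewrite !mulmxDr !scalerDr -!scalemxAr !Tpin.
by rewrite !scalerA ![t 0 0 * _]mulrC.
Qed.

(** [l, l] fixes 1, and it fixes y exactly if l commutes with y. *)
Lemma fix_dim_isotropy_q1 : fix_dim (isotropy (pin_group R a) (q1 R)) 1.
Proof.
have fixed s d y : pin_group R a (qrot (pin s d) (pin s d)) ->
    Fix (isotropy (pin_group R a) (q1 R)) y ->
    qmul (pin s d) y = qmul y (pin s d).
  set l := pin s d => Ml Fy.
  have ul : qmul (qconj l) l = q1 R by apply: pin_unit.
  have lr : qmul l (qconj l) = q1 R.
    by rewrite -{1}[l]qconjK /l pin_conj; apply: pin_unit.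
  have : isotropy (pin_group R a) (q1 R) (qrot l l).
    by split => //; rewrite qrotE qmulq1.
  move=> /Fy; rewrite qrotE => E.
  by rewrite -[in RHS]E -qmulA ul qmulq1.
exists <[q1 R]>%VS; split; last first.
  rewrite dim_vline; suff -> : q1 R != 0 by [].
  by apply/eqP => /colP/(_ 0); rewrite !mxE /=; apply/eqP; rewrite oner_eq0.
apply/seteqP; split => y /=.
  move=> Fy; apply/vlineP; exists (y 0 0); apply: commute_ej_real.
    rewrite /e_ qexpi_pin; apply: fixed => //.
    by exists 1, (pi / a%:R), false, false; rewrite mul1r.
  rewrite qj_pin; apply: fixed => //.
  by exists 0, 0, true, true; rewrite mul0r.
by move=> /vlineP[c ->] g [_ g1]; rewrite -scalemxAr g1.
Qed.

End Representation.

Lemma pin_group_dvd (R : realType) a a' : (0 < a')%N -> (a %| a')%N ->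
  pin_group R a `<=` pin_group R a'.
Proof.
move=> a'0 /dvdnP[q qa] _ [k [t [e [d ->]]]].
have [q0 a0] : q%:R != 0 :> R /\ a%:R != 0 :> R.
  by move: a'0; rewrite qa muln_gt0 !lt0n => /andP[q0 a0]; rewrite !pnatr_eq0.
exists (k * q%:Z), t, e, d; congr (qrot (pin _ e) _).
by rewrite qa intrM -pmulrn natrM; field; rewrite q0 a0.
Qed.

Theorem theorem1p3 (R : realType) :
  (forall a : nat, odd a -> (3 <= a)%N ->
     [/\ Hbar R a =
           generated ([set qrot (e_ R a) (q1 R); qrot (q1 R) (qj R);
                           qrot (qj R) (q1 R)] `|`
                      [set qrot (q1 R) (qexpi psi) | psi in [set: R]]),
         compact (Hbar R a) /\ lie_group 1 (Hbar R a),
         absolutely_irreducible (Hbar R a) &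
         exists2 K, isotropy_subgroup (Hbar R a) K & fix_dim K 1]) /\
  (forall a a' : nat, odd a -> (3 <= a)%N -> odd a' -> (3 <= a')%N ->
     (a < a')%N -> (a %| a')%N -> subgroup_of (Hbar R a') (Hbar R a)).
Proof.
split=> [a _ a3|a a' _ a3 _ a'3 _ aa'].
  have a0 : (0 < a)%N by apply: leq_trans a3.
  rewrite (Hbar_pin_group R a0) (generated_pin_group R a0); split => //.
  - by split; [exact: compact_pin_group|exact: lie_group_pin_group].
  - exact: absolutely_irreducible_pin_group.
  - exists (isotropy (pin_group R a) (q1 R)); first by exists (q1 R).
    exact: fix_dim_isotropy_q1.
have [a0 a'0] : (0 < a)%N /\ (0 < a')%N.
  by split; apply: leq_trans (isT : 0 < 3)%N _.
rewrite !Hbar_pin_group //; have [_ M1 MM MV] := pin_group_subgroup R a0.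
by split => //; apply: pin_group_dvd.
Qed.
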